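(* Catalan inversion sequences grow according to the succession rule \[\Omega_{Cat}=\left\{\begin{array}{l}(1)\\ (k)\rightsquigarrow (1),(2),\ldots,(k),(k+1).\end{array}\right.\]
   Context: An inversion sequence of length (size) $n\ge 1$ is an integer sequence $e=(e_1,\ldots,e_n)$ with $0\le e_i<i$ for all $i$. A Catalan inversion sequence is an element of $\mathbf{I}(\geq,-,\geq)$, i.e. an inversion sequence with no three indices $i<j<k$ such that $e_i\ge e_j$ and $e_i\ge e_k$. A generating tree for a combinatorial class $\mathcal{C}$ (with finitely many objects of each size and exactly one object of size $1$) is an infinite rooted tree whose vertices are the objects of $\mathcal{C}$, each appearing exactly once, with objects of size $n$ at level $n$ (the root being at level $1$); the children of an object $c$ are obtained by adding to $c$ an atom (a piece of object increasing the size by $1$) following some prescribed rules. A succession rule consists of a starting label (the axiom) and, for each label, a multiset of produced labels (its productions). The class $\mathcal{C}$ grows according to a succession rule $\Omega$ if there are a generating tree for $\mathcal{C}$ and an assignment of labels to the objects of $\mathcal{C}$ such that the root carries the axiom and, for each object with label $\ell$, the multiset of labels of its children is exactly the multiset of productions of $\ell$ in $\Omega$. In the rule above, the axiom is $(1)$ and label $(k)$ produces $(j)$ once for each $1\le j\le k+1$. *)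

(* Defs.v *)
From mathcomp Require Import all_boot.

Set Implicit Arguments.
Unset Strict Implicit.
Unset Printing Implicit Defensive.

(* [adds_atom c c'] : the object c' is obtained from c by adding one atom.
   The notion of atom is part of the data of a class.                        *)
Record comb_class := CombClass {
  obj :> eqType;
  csize : obj -> nat;
  adds_atom : obj -> obj -> Prop;
  csize_gt0 : forall c : obj, 0 < csize c;
  csize_fin : forall n, exists s : seq obj, forall c, csize c = n -> c \in s;
  csize_one : exists! c : obj, csize c = 1;
  csize_atom : forall c c', adds_atom c c' -> csize c' = (csize c).+1
}.

(* The tree is given by its root and by the finite list of children of each
   object.  As adding an atom increases the size by 1, an object of size n lies
   at level n, and iterating gt_parent leads from any object to the root.    *)
Record generating_tree (C : comb_class) := GeneratingTree {
  root : C;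
  children : C -> seq C;
  gt_root : csize root = 1;
  gt_atom : forall c c', c' \in children c -> adds_atom c c';
  gt_uniq : forall c, uniq (children c);
  gt_parent : forall c, c <> root -> exists! p, c \in children p;
  gt_infinite : forall n, exists c : C, n < csize c
}.

(* The multiset of productions of a label is a list, taken up to [perm_eq].  *)
Record succession_rule := SuccessionRule {
  label : eqType;
  axiom : label;
  productions : label -> seq label
}.

Definition grows_according_to (C : comb_class) (W : succession_rule) : Prop :=
  exists (t : generating_tree C) (lab : C -> label W),
    lab (root t) = axiom W /\
    forall c, perm_eq [seq lab c' | c' <- children t c] (productions (lab c)).

(* Only labels k >= 1 are reachable from the axiom.                           *)
Definition Omega_Cat : succession_rule :=
  @SuccessionRule nat 1 (fun k => iota 1 k.+1).

(* Entries are indexed from 0 here and from 1 in the usual definition, whose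
   condition e_i < i therefore becomes [nth 0 e i < i.+1].                    *)
Definition inversion_seq (e : seq nat) : bool :=
  (0 < size e) && [forall i : 'I_(size e), nth 0 e i < i.+1].

Definition catalan_inversion_seq (e : seq nat) : bool :=
  inversion_seq e &&
  ~~ [exists i : 'I_(size e), exists j : 'I_(size e), exists k : 'I_(size e),
       [&& i < j, j < k, nth 0 e i >= nth 0 e j & nth 0 e i >= nth 0 e k]].

Definition cat_inv : Type := {e : seq nat | catalan_inversion_seq e}.

(* An atom of an inversion sequence is one entry, inserted at any place.     *)
Definition inserts_entry (e e' : seq nat) : Prop :=
  exists i x, i <= size e /\ e' = take i e ++ x :: drop i e.

Definition cat_size (c : cat_inv) : nat := size (val c).

Definition cat_adds_atom (c c' : cat_inv) : Prop :=
  inserts_entry (val c) (val c').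

Lemma cat_size_gt0 (c : cat_inv) : 0 < cat_size c.
Proof. by rewrite /cat_size; case: c => e /= /andP[/andP[]]. Qed.

Lemma cat_entry_lt (c : cat_inv) (i : 'I_(size (val c))) :
  nth 0 (val c) i < i.+1.
Proof. by case: c i => e /= /andP[/andP[_ /forallP ce] _] i; apply: ce. Qed.

Lemma cat_size_fin n :
  exists s : seq cat_inv, forall c, cat_size c = n -> c \in s.
Proof.
exists (pmap insub [seq map val (val t) | t <- enum {: n.-tuple 'I_n}]).
move=> c cn; rewrite mem_pmap_sub /=.
have ce := @cat_entry_lt c.
have clt : all (fun x => x < n) (val c).
  apply/(all_nthP 0) => i ic; apply: leq_trans (ce (Ordinal ic)) _ => /=.
  by rewrite -cn.
have cE : map val (pmap (insub : nat -> option 'I_n) (val c)) = val c.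
  by rewrite (pmap_filter (insubK _)); apply/all_filterP;
    apply: sub_all clt => x xn; rewrite /= insubT.
have sz : size (pmap (insub : nat -> option 'I_n) (val c)) == n.
  by rewrite -(size_map val) cE -cn.
by apply/mapP; exists (Tuple sz); rewrite ?mem_enum //= cE.
Qed.

Lemma cat_size_one : exists! c : cat_inv, cat_size c = 1.
Proof.
have c0 : catalan_inversion_seq [:: 0].
  apply/andP; split; first by apply/andP; split=> //; apply/forallP => i; rewrite ord1.
  apply/existsP => -[i] /existsP[j] /existsP[k] /and4P[ij _ _ _].
  by move: ij; rewrite [i]ord1 [j]ord1.
exists (exist _ [:: 0] c0); split=> // c c1; apply: val_inj => /=.
have ce := @cat_entry_lt c.
move: c1 ce; rewrite /cat_size -[sval c]/(val c).
case: (val c) => [|x [|y s]] //= _ /(_ ord0) /=.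
by case: x.
Qed.

Lemma cat_size_atom (c c' : cat_inv) :
  cat_adds_atom c c' -> cat_size c' = (cat_size c).+1.
Proof.
case=> i [x [ile cE]].
by rewrite /cat_size cE size_cat /= addnS -size_cat cat_take_drop.
Qed.

Definition catalan_inversion_sequences : comb_class :=
  CombClass cat_size_gt0 cat_size_fin cat_size_one cat_size_atom.

(* Main.v *)
Require Import Defs.
From mathcomp Require Import all_boot.

Set Implicit Arguments.
Unset Strict Implicit.
Unset Printing Implicit Defensive.

(** Positions are counted from 0, so the entries satisfy [e_i <= i].  Call the
    entry at position [i] saturated when [e_i = i].  The first entry is always
    saturated, and the tree is the one in which the parent of a sequence is
    obtained by deleting its last saturated entry.  Deletion preserves pattern
    avoidance, and it preserves the bounds because the entries that move one
    step to the left are not saturated.  Conversely, inserting the value [p]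
    at position [p] moves the later entries one step to the right, which makes
    them unsaturated, so the inserted entry is the last saturated one.  Every
    inversion sequence of size at least 2 therefore arises exactly once as
    [insert_saturated e p] ([last_saturated], [insert_saturated_inj]).

    The entries before position [p] are smaller than [p], so inserting [p]
    there keeps the avoidance if and only if at most one entry of [e] from
    position [p] on is at most [p]
    ([insert_saturated_avoids]); call such a [p] a site of [e].  Let [n] be the
    size of [e].  After an insertion at [p], the sites [q < p] are unchanged,
    since the new entry exceeds [q]; a position [q] with [p <= q < n] is no
    site, since the entries at [q] and [q + 1] are both at most [q]; and [n]
    and [n + 1] are always sites ([active_insert_saturated]).  Thus if [e] has
    sites [p_0 < ... < p_k], the child given by [p_r] has [r + 2] sites.  With
    the number of sites minus 1 as label, the children of an object labelled
    [k] have the labels [1, ..., k + 1] ([map_sites_label]). *)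

(** * Recursive description of Catalan inversion sequences *)

Fixpoint bounded_from k (s : seq nat) : bool :=
  if s is x :: s' then (x <= k) && bounded_from k.+1 s' else true.

(** The pattern is avoided exactly when no entry is followed by two entries that
    are at most as large; this form behaves well under insertion. *)
Fixpoint avoids_cat (s : seq nat) : bool :=
  if s is x :: s' then (count (geq x) s' <= 1) && avoids_cat s' else true.

Lemma bounded_fromP k s :
  reflect (forall i, i < size s -> nth 0 s i <= k + i) (bounded_from k s).
Proof.
elim: s k => [|x s IHs] k /=; first by constructor.
apply: (iffP andP) => [[xk /IHs sk] [|i] /= si | sk].
- by rewrite addn0.
- by rewrite addnS -addSn sk.
split; first by rewrite -[k]addn0 (sk 0).
by apply/IHs => i si; rewrite addSn -addnS (sk i.+1).
Qed.

Lemma bounded_from_cat k s t :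
  bounded_from k (s ++ t) = bounded_from k s && bounded_from (k + size s) t.
Proof.
elim: s k => [|x s IHs] k /=; first by rewrite addn0.
by rewrite IHs addSnnS andbA.
Qed.

Lemma bounded_fromS k s : bounded_from k s -> bounded_from k.+1 s.
Proof. by elim: s k => //= x s IHs k /andP[/leqW-> /IHs->]. Qed.

Lemma bounded_from_lt k s : bounded_from k s -> all (gtn (k + size s)) s.
Proof.
elim: s k => //= x s IHs k /andP[xk /IHs]; rewrite addSnnS => ->.
by rewrite andbT addnS ltnS (leq_trans xk) ?leq_addr.
Qed.

Lemma count_gt1P (a : pred nat) s :
  1 < count a s <->
  exists j k, [/\ j < k, k < size s, a (nth 0 s j) & a (nth 0 s k)].
Proof.
elim: s => [|x s IHs] /=; first by split=> // -[j [k []]].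
split=> [|[[|j] [[|k] []]] //=].
- case: (boolP (a x)) => [ax|_].
    rewrite ltnS -has_count => /(has_nthP 0)[k ks ak].
    by exists 0, k.+1.
  by rewrite add0n => /IHs[j [k [jk ks aj ak]]]; exists j.+1, k.+1.
- by move=> _ ks -> ak; rewrite ltnS -has_count; apply/(has_nthP 0); exists k.
- move=> jk ks aj ak; apply: leq_trans (leq_addl _ _).
  by apply/IHs; exists j, k.
Qed.

Lemma avoids_catP s :
  reflect (forall i j k, i < j -> j < k -> k < size s ->
             ~ (nth 0 s j <= nth 0 s i /\ nth 0 s k <= nth 0 s i))
          (avoids_cat s).
Proof.
elim: s => [|x s IHs] /=; first by constructor.
apply: (iffP andP) => [[sx /IHs av] [|i] [|j] [|k] //= ij jk ks | av].
- case=> jx kx; move: sx; rewrite leqNgt => /negP[].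
  by apply/count_gt1P; exists j, k.
- exact: av.
split.
  rewrite leqNgt; apply/negP => /count_gt1P[j [k [jk ks jx kx]]].
  by apply: (av 0 j.+1 k.+1).
by apply/IHs => i j k ij jk ks; apply: (av i.+1 j.+1 k.+1).
Qed.

Lemma catalan_inversion_seqE e :
  catalan_inversion_seq e = [&& e != [::], bounded_from 0 e & avoids_cat e].
Proof.
rewrite /catalan_inversion_seq /inversion_seq lt0n size_eq0 -andbA.
congr [&& _, _ & _].
  apply/forallP/bounded_fromP => [be i ie | be i]; last exact: be.
  exact: (be (Ordinal ie)).
apply/idP/avoids_catP => [av i j k ij jk ke [ji ki] | av].
  have je := ltn_trans jk ke; have ie := ltn_trans ij je.
  case/negP: av; apply/existsP; exists (Ordinal ie).
  apply/existsP; exists (Ordinal je); apply/existsP; exists (Ordinal ke).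
  exact/and4P.
apply/existsP => -[i] /existsP[j] /existsP[k] /and4P[ij jk ji ki].
exact: (av i j k).
Qed.

(** * Inserting a saturated entry *)

Definition insert_saturated (e : seq nat) p := take p e ++ p :: drop p e.

Definition active e p := count (geq p) (drop p e) <= 1.

Definition sites e := [seq p <- iota 0 (size e).+1 | active e p].

Lemma size_insert_saturated e p : size (insert_saturated e p) = (size e).+1.
Proof. by rewrite size_cat /= addnS -size_cat cat_take_drop. Qed.

Lemma nth_insert_saturated e p :
  p <= size e -> nth 0 (insert_saturated e p) p = p.
Proof. by move=> pe; rewrite nth_cat size_takel // ltnn subnn. Qed.

Lemma nth_insert_saturated_gt e p q :
  p <= q -> q < size e -> nth 0 (insert_saturated e p) q.+1 = nth 0 e q.
Proof.
move=> pq qe; have pe := leq_trans pq (ltnW qe).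
by rewrite nth_cat size_takel // ltnNge leqW //= subSn //= nth_drop subnKC.
Qed.

(** The position of the insertion can be read off the result, since it is the last
    position holding its own index. *)
Lemma insert_saturated_inj e e' p p' :
  bounded_from 0 e -> bounded_from 0 e' -> p <= size e -> p' <= size e' ->
  insert_saturated e p = insert_saturated e' p' -> e = e' /\ p = p'.
Proof.
have no_lt e1 e2 p1 p2 : bounded_from 0 e1 -> p2 <= size e2 ->
    insert_saturated e1 p1 = insert_saturated e2 p2 -> p2 <= p1.
  (* If [p1 < p2], then position [p2] of the common result holds both [p2] and
     the entry of [e1] at [p2 - 1], which is at most [p2 - 1]. *)
  move=> /bounded_fromP b1 p2e E; case: (leqP p2 p1) => // p12.
  have [sz] : (size e1).+1 = (size e2).+1.
    by rewrite -(size_insert_saturated e1 p1) E size_insert_saturated.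
  case: p2 p12 p2e E => // q p1q qe E.
  rewrite -sz in qe.
  have := nth_insert_saturated_gt (q := q) p1q qe.
  rewrite E nth_insert_saturated -?sz // => Eq.
  by have := b1 q qe; rewrite -Eq add0n ltnn.
move=> b b' pe p'e E; have pp' : p = p'.
  apply/eqP; rewrite eqn_leq (no_lt _ _ _ _ b' pe (esym E)).
  exact: (no_lt _ _ _ _ b p'e E).
split=> //; subst p'; move/eqP: E.
rewrite eqseq_cat ?size_takel // eqseq_cons => /and3P[/eqP Et _ /eqP Ed].
by rewrite -(cat_take_drop p e) Et Ed cat_take_drop.
Qed.

(** The inserted entry is the last saturated one of [s], which exists because the
    first entry is 0. *)
Lemma last_saturated s : s != [::] -> bounded_from 0 s ->
  exists e p,
    [/\ p <= size e, bounded_from 0 e & s = insert_saturated e p].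
Proof.
have ins_cat s1 s2 : insert_saturated (s1 ++ s2) (size s1) = s1 ++ size s1 :: s2.
  by rewrite /insert_saturated take_size_cat // drop_size_cat.
move=> s0 bs.
suff [s1 [s2 [-> b1 b2]]] : exists s1 s2, [/\ s = s1 ++ size s1 :: s2,
    bounded_from 0 s1 & bounded_from (size s1) s2].
  exists (s1 ++ s2), (size s1); split=> //; first by rewrite size_cat leq_addr.
  by rewrite bounded_from_cat b1.
(* What follows the last saturated entry is unsaturated, hence satisfies the
   bounds after moving one step to the left.  Appending an unsaturated entry
   preserves this decomposition. *)
elim/last_ind: s s0 bs => // s x IHs _.
rewrite -cats1 bounded_from_cat add0n /= andbT => /andP[bs].
rewrite leq_eqVlt => /orP[/eqP-> | xs]; first by exists s, [::].
have [|s1 [s2 [sE b1 b2]]] := IHs _ bs; first by case: (s) xs.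
exists s1, (rcons s2 x); rewrite {1}sE -catA cats1 /=; split=> //.
rewrite -cats1 bounded_from_cat b2 /= andbT.
by move: xs; rewrite sE size_cat /= addnS ltnS.
Qed.

Lemma insert_saturated_bounded e p :
  p <= size e -> bounded_from 0 e -> bounded_from 0 (insert_saturated e p).
Proof.
move=> pe; rewrite -{1}(cat_take_drop p e) !bounded_from_cat /= !add0n.
by rewrite size_takel // leqnn => /andP[-> /bounded_fromS].
Qed.

(** Entries to the left of the new one are smaller than it, so it does not count
    among the later entries at most as large as they are; the only new condition
    is that of the new entry itself. *)
Lemma insert_saturated_avoids e p :
  p <= size e -> bounded_from 0 e ->
  avoids_cat (insert_saturated e p) = avoids_cat e && active e p.
Proof.
move=> pe be; rewrite /insert_saturated /active -{3}(cat_take_drop p e).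
have : all (gtn p) (take p e).
  move: be; rewrite -{1}(cat_take_drop p e) bounded_from_cat => /andP[+ _].
  by move/bounded_from_lt; rewrite size_takel.
move: (drop p e) => t; elim: (take p e) => [|y s IHs] /=.
  by rewrite andbC.
case/andP=> yp /IHs->; rewrite !count_cat /= andbA.
by rewrite [p <= y]leqNgt yp add0n.
Qed.

Lemma mem_sites e p : (p \in sites e) = (p <= size e) && active e p.
Proof. by rewrite mem_filter mem_iota /= add0n ltnS andbC. Qed.

Lemma size_in_sites e : size e \in sites e.
Proof. by rewrite mem_sites leqnn /active drop_size. Qed.

Lemma insert_saturated_catalan e p : p <= size e -> bounded_from 0 e ->
  catalan_inversion_seq (insert_saturated e p) = avoids_cat e && active e p.
Proof.
move=> pe be; rewrite catalan_inversion_seqE -size_eq0 size_insert_saturated.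
by rewrite insert_saturated_bounded // insert_saturated_avoids.
Qed.

(** * The sites of a child *)

(** For [p <= q < size e], the entries of the child at [q] and [q.+1] are both at
    most [q]: the first by the bounds of the child, and the second because it is
    the entry of [e] at [q]. *)
Lemma active_insert_saturated e p q :
  p <= size e -> bounded_from 0 e -> q <= (size e).+1 ->
  active (insert_saturated e p) q = if q < p then active e q else size e <= q.
Proof.
move=> pe be qe; case: (ltnP q p) => [qp | pq].
  rewrite /active -[in RHS](cat_take_drop p e) !drop_cat size_takel // qp.
  by rewrite !count_cat /= [p <= q]leqNgt qp add0n.
have sz := size_insert_saturated e p.
rewrite /active; case: (leqP (size e) q) => [eq_ | ltqe].
  by rewrite (leq_trans (count_size _ _)) // size_drop sz leq_subLR addn1 ltnS.
have lt_q : q < (size e).+1 := ltnW ltqe.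
rewrite (drop_nth 0 (n := q)) ?sz // (drop_nth 0 (n := q.+1)) ?sz //=.
rewrite nth_insert_saturated_gt //.
have /bounded_fromP/(_ q) := insert_saturated_bounded pe be.
have /bounded_fromP/(_ q ltqe) := be.
by rewrite sz add0n => -> ->.
Qed.

(** The two extra sites are [size e] and [(size e).+1]. *)
Lemma size_sites_insert_saturated e p : p <= size e -> bounded_from 0 e ->
  size (sites (insert_saturated e p)) = (count (gtn p) (sites e)).+2.
Proof.
move=> pe be; rewrite /sites size_insert_saturated count_filter size_filter.
have act q := active_insert_saturated pe be (q := q).
rewrite -[(size e).+2]addn2 -[(size e).+1]addn1 !iotaD !count_cat /= add0n.
rewrite !act // !ltnNge pe leqnn leqnSn (leq_trans pe) //= !addn0 addn2.
congr _.+2; apply: eq_in_count => q; rewrite mem_iota /= add0n => qe.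
rewrite act ?(leqW (ltnW qe)) // [size e <= q]leqNgt qe.
by case: (q < p).
Qed.

Lemma count_lt_sorted s : sorted ltn s ->
  [seq count (gtn p) s | p <- s] = iota 0 (size s).
Proof.
elim: s => //= x s IHs xs; rewrite ltnn.
have /allP xlt := order_path_min ltn_trans xs.
rewrite (@eq_in_count _ _ pred0) ?count_pred0; last first.
  by move=> y /xlt /= xy; rewrite ltnNge ltnW.
congr (_ :: _); rewrite -[1]addn0 iotaDl -IHs ?(path_sorted xs) // -map_comp.
by apply/eq_in_map => y /xlt /= ->.
Qed.

(** * Labels and the generating tree *)

Definition sites_label e := (size (sites e)).-1.

(** The child given by the [r]-th site, counted from 0, has [r] sites below that
    site and two more, hence label [r.+1]. *)
Lemma map_sites_label e : bounded_from 0 e ->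
  [seq sites_label (insert_saturated e p) | p <- sites e]
    = iota 1 (sites_label e).+1.
Proof.
move=> be; rewrite /sites_label prednK; last first.
  by case: (sites e) (size_in_sites e).
rewrite -[1]addn0 iotaDl -count_lt_sorted; last first.
  exact: sorted_filter ltn_trans _ _ (iota_ltn_sorted _ _).
rewrite -map_comp; apply/eq_in_map => p.
by rewrite mem_sites => /andP[pe _] /=; rewrite size_sites_insert_saturated.
Qed.

Lemma cat_inv_bounded (c : cat_inv) : bounded_from 0 (val c).
Proof. by case: c => e /=; rewrite catalan_inversion_seqE => /and3P[]. Qed.

Definition cat_children (c : cat_inv) : seq cat_inv :=
  pmap insub [seq insert_saturated (val c) p | p <- sites (val c)].

Lemma mem_cat_children (c c' : cat_inv) :
  reflect (exists2 p, p <= size (val c) & val c' = insert_saturated (val c) p)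
          (c' \in cat_children c).
Proof.
rewrite mem_pmap_sub; apply: (iffP mapP) => -[p + E].
  by rewrite mem_sites => /andP[pe _]; exists p.
move=> pe; exists p => //; rewrite mem_sites pe /=.
have := valP c'; rewrite E insert_saturated_catalan ?cat_inv_bounded //.
by case/andP.
Qed.

Lemma val_cat_children (c : cat_inv) :
  map val (cat_children c)
    = [seq insert_saturated (val c) p | p <- sites (val c)].
Proof.
rewrite /cat_children (pmap_filter (insubK _)); apply/all_filterP/allP => e.
case/mapP=> p; rewrite mem_sites => /andP[pe ap] ->.
rewrite isSome_insub insert_saturated_catalan ?cat_inv_bounded // ap andbT.
by have := valP c; rewrite catalan_inversion_seqE => /and3P[].
Qed.

Lemma cat_children_atom (c c' : cat_inv) :
  c' \in cat_children c -> cat_adds_atom c c'.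
Proof. by case/mem_cat_children=> p pe E; exists p, p. Qed.

Lemma cat_children_uniq (c : cat_inv) : uniq (cat_children c).
Proof.
rewrite -(map_inj_uniq val_inj) val_cat_children map_inj_in_uniq.
  exact/filter_uniq/iota_uniq.
move=> p q; rewrite !mem_sites => /andP[pe _] /andP[qe _].
by case/insert_saturated_inj; rewrite ?cat_inv_bounded.
Qed.

Lemma cat_parent (c : cat_inv) :
  1 < size (val c) -> exists! p, c \in cat_children p.
Proof.
move=> c1; have := valP c; rewrite catalan_inversion_seqE => /and3P[c0 bc avc].
have [e [p [pe be cE]]] := last_saturated c0 bc.
have e_cat : catalan_inversion_seq e.
  rewrite catalan_inversion_seqE be -size_eq0 -lt0n.
  move: avc c1; rewrite cE insert_saturated_avoids // => /andP[-> _].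
  by rewrite size_insert_saturated ltnS => ->.
exists (Sub e e_cat); split=> [|d /mem_cat_children[q qd cE']].
  by apply/mem_cat_children; exists p.
apply: val_inj; rewrite cE in cE'.
by case: (insert_saturated_inj be (cat_inv_bounded d) pe qd cE').
Qed.

Lemma cat_inv_unbounded n : exists c : cat_inv, n < size (val c).
Proof.
elim: n => [|n [c nc]].
  by have [c [c1 _]] := cat_size_one; exists c; rewrite -[size _]/(cat_size c) c1.
have : insert_saturated (val c) (size (val c)) \in map val (cat_children c).
  by rewrite val_cat_children map_f ?size_in_sites.
by case/mapP=> c' _ E; exists c'; rewrite -E size_insert_saturated ltnS.
Qed.

Theorem proposition3 :
  grows_according_to catalan_inversion_sequences Omega_Cat.
Proof.
have cat0 : catalan_inversion_seq [:: 0] by rewrite catalan_inversion_seqE.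
pose c0 : cat_inv := Sub [:: 0] cat0.
have parent (c : catalan_inversion_sequences) :
    c <> c0 -> exists! p, c \in cat_children p.
  move=> cN0; apply: cat_parent; rewrite ltn_neqAle cat_size_gt0 andbT.
  apply/eqP=> c1; apply: cN0; have [r [_ rU]] := cat_size_one.
  exact: etrans (esym (rU c (esym c1))) (rU c0 erefl).
exists (@GeneratingTree catalan_inversion_sequences c0 cat_children erefl
  cat_children_atom cat_children_uniq parent cat_inv_unbounded).
exists (fun c : cat_inv => sites_label (val c)); split=> // c.
rewrite [map _ _](map_comp sites_label val) val_cat_children -map_comp.
by rewrite map_sites_label ?cat_inv_bounded.
Qed.
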